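(* Let $n\ge1$, $p>2$, $0<\lambda\le\Lambda$, and let $0<m_0<1$ and $L_0>1$ be universal constants with property (P) stated in the context. Assume $u:Q_3^-\to\mathbb{R}$ is a nonnegative viscosity supersolution of $$\partial_tu-|Du|^{p-2}\mathcal{P}^-_{\lambda,\Lambda}(D^2u)\ge0$$ in $Q_3^-$ with $u(0,0)\le m_0$. Then for any $k\in\mathbb{N}=\{1,2,\dots\}$ and for any $(x_0,t_0)\in B_{4/3}\times(-3,-1+32^{-kp}]$ there is $\bar x\in B_{32^{-k}}(x_0)$ such that $$u(\bar x,t_0)\le L_0^k m_0 .$$
   Context: Universal constant: a constant depending only on $n,p,\lambda,\Lambda$. $B_\rho(x)$ is the ball in $\mathbb{R}^n$ of radius $\rho$ centered at $x$, $B_\rho=B_\rho(0)$, and $Q_3^-=B_3\times(-3^p,0]$. Pucci operator: for a symmetric $n\times n$ matrix $M$ with eigenvalues $e_i$, $\mathcal{P}^-_{\lambda,\Lambda}(M)=\lambda\sum_{e_i>0}e_i+\Lambda\sum_{e_i<0}e_i$. $Du$, $D^2u$ denote the gradient and Hessian in space. Viscosity supersolution: for $\Omega=U\times(T_1,T_2]$, a lower semicontinuous $u:\Omega\to\mathbb{R}$ is a viscosity supersolution of $\partial_tu-|Du|^{p-2}\mathcal{P}^-_{\lambda,\Lambda}(D^2u)\ge0$ if, whenever $\varphi\in C^2(\Omega)$ satisfies $\varphi\le u$ at all $(x,t)\in\Omega$ with $t\le t_0$ and $\varphi(x_0,t_0)=u(x_0,t_0)$ at some $(x_0,t_0)\in\Omega$,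 one has $\partial_t\varphi(x_0,t_0)-|D\varphi(x_0,t_0)|^{p-2}\mathcal{P}^-_{\lambda,\Lambda}(D^2\varphi(x_0,t_0))\ge0$. Property (P) of $m_0,L_0$ (such universal constants exist): for every nonnegative viscosity supersolution $u:Q_3^-\to\mathbb{R}$ of $\partial_tu-|Du|^{p-2}\mathcal{P}^-_{\lambda,\Lambda}(D^2u)\ge0$ with $u(0,0)\le m_0$ and every $(x_0,t_0)\in B_{4/3}\times(-3,-\tfrac12]$ there exists $\bar x\in B_{1/32}(x_0)$ with $u(\bar x,t_0)\le L_0m_0$. *)

(* Defs.v *)
From HB Require Import structures.
From mathcomp Require Import all_boot all_order all_algebra.
From mathcomp Require Import all_classical all_reals all_analysis.
From mathcomp Require Import complex.
Set Implicit Arguments.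
Unset Strict Implicit.
Unset Printing Implicit Defensive.
Import Order.TTheory GRing.Theory Num.Theory.
Import numFieldNormedType.Exports.
Local Open Scope classical_set_scope.
Local Open Scope ring_scope.

(* The library norm on 'rV[R]_n is the sup norm, hence the explicit Euclidean
   norm; both induce the same topology. *)
Definition enorm (R : realType) (n : nat) (x : 'rV[R]_n) : R :=
  Num.sqrt (\sum_(i < n) x 0 i ^+ 2).

Definition eball (R : realType) (n : nat) (x : 'rV[R]_n) (r : R) :
  set 'rV[R]_n := [set y | enorm (y - x) < r].

Definition cylinder (R : realType) (n : nat) (U : set 'rV[R]_n) (T1 T2 : R) :
  set ('rV[R]_n * R) := U `*` `]T1, T2]%classic.

Definition Q3minus (R : realType) (n : nat) (p : R) : set ('rV[R]_n * R) :=
  cylinder (eball 0 3) (- (3 `^ p)) 0.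

(* The eigenvalues listed with multiplicity (in an unspecified order).  The
   default value is not reached on symmetric matrices, see [eigenvaluesP]. *)
Definition eigenvalues (R : realType) (n : nat) (M : 'M[R]_n) : seq R :=
  xget [::] [set e : seq R | char_poly M = \prod_(x <- e) ('X - x%:P)].

Definition pucci_minus (R : realType) (n : nat) (lam Lam : R) (M : 'M[R]_n) :
    R :=
  lam * (\sum_(e <- eigenvalues M | 0 < e) e) +
  Lam * (\sum_(e <- eigenvalues M | e < 0) e).

Lemma char_poly_similar (F : fieldType) (n : nat) (P D : 'M[F]_n) :
  P \in unitmx -> char_poly (invmx P *m D *m P) = char_poly D.
Proof.
move=> Pu.
have e : map_mx polyC (invmx P) *m map_mx polyC P = 1%:M :> 'M[{poly F}]_n.
  by rewrite -map_mxM /= mulVmx // map_mx1.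
have -> : char_poly (invmx P *m D *m P) =
    \det (map_mx polyC (invmx P) *m char_poly_mx D *m map_mx polyC P).
  rewrite /char_poly /char_poly_mx mulmxBr mulmxBl !map_mxM /=.
  by rewrite mul_mx_scalar -scalemxAl e scalemx1.
by rewrite !det_mulmx mulrAC -det_mulmx e det1 mul1r.
Qed.

Lemma eigenvaluesP (R : realType) (n : nat) (M : 'M[R]_n) :
  M^T = M -> char_poly M = \prod_(e <- eigenvalues M) ('X - e%:P).
Proof.
move=> sM; suff [e eP] : exists e : seq R,
    char_poly M = \prod_(x <- e) ('X - x%:P).
  by rewrite /eigenvalues; case: xgetP => [s _ //|/(_ e)].
pose f := real_complex R.
pose A : 'M[R[i]%C]_n := map_mx f M.
have Ah : A \is hermsymmx.
  apply/is_hermitianmxP; rewrite expr0 scale1r; apply/matrixP => i j.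
  rewrite !mxE -[in RHS](_ : M i j = M j i); last by rewrite -[in LHS]sM mxE.
  by rewrite /f/= conj_Creal // complex_real.
have /orthomx_spectralP AE := hermitian_normalmx Ah.
have /mxOverP dr := hermitian_spectral_diag_real Ah.
exists [seq complex.Re (spectral_diag A 0 i) | i <- enum 'I_n].
apply: (map_poly_inj f); rewrite map_char_poly -/A AE.
rewrite char_poly_similar ?spectral_unit //.
rewrite char_poly_trig ?diag_mx_is_trig // big_map rmorph_prod big_enum /=.
apply: eq_bigr => i _.
rewrite rmorphB /= map_polyX map_polyC /= !mxE eqxx mulr1n.
by rewrite -AE /f/= RRe_real // dr.
Qed.

(* C^k on an open set [O]; [f] is total but only its values on [O] matter. *)
Fixpoint Ck_on (R : realType) (V : normedModType R) (k : nat) (O : set V)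
    (f : V -> R) : Prop :=
  if k is k'.+1 then
    (forall z, O z -> differentiable f z) /\
    (forall v, Ck_on k' O (fun z => 'D_v f z))
  else forall z, O z -> {for z, continuous f}.

(* C^2 on a set which need not be open, such as a cylinder containing its top:
   C^2 on a neighbourhood of that set. *)
Definition C2 (R : realType) (V : normedModType R) (Omega : set V)
    (f : V -> R) : Prop :=
  exists O : set V, [/\ open O, Omega `<=` O & Ck_on 2 O f].

Section SpaceTimeDerivatives.
Variables (R : realType) (n : nat).
Implicit Types (f : 'rV[R]_n * R -> R) (z : 'rV[R]_n * R).

Definition dt f z : R := 'D_(0, 1) f z.

Definition dx (i : 'I_n) f z : R := 'D_(delta_mx 0 i, 0) f z.

Definition grad f z : 'rV[R]_n := \row_i dx i f z.

Definition hess f z : 'M[R]_n := \matrix_(i, j) dx i (dx j f) z.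

End SpaceTimeDerivatives.

(* [u] is total, but only its values on the cylinder matter; [subspace] makes
   semicontinuity relative to the cylinder. *)
Definition viscosity_supersolution (R : realType) (n : nat) (p lam Lam : R)
    (U : set 'rV[R]_n) (T1 T2 : R) (u : 'rV[R]_n * R -> R) : Prop :=
  let Omega := cylinder U T1 T2 in
  lower_semicontinuous (fun z : subspace Omega => (u z)%:E) /\
  forall (phi : 'rV[R]_n * R -> R) (x0 : 'rV[R]_n) (t0 : R),
    C2 Omega phi ->
    Omega (x0, t0) ->
    (forall x t, Omega (x, t) -> t <= t0 -> phi (x, t) <= u (x, t)) ->
    phi (x0, t0) = u (x0, t0) ->
    0 <= dt phi (x0, t0) -
         enorm (grad phi (x0, t0)) `^ (p - 2) *
         pucci_minus lam Lam (hess phi (x0, t0)).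

Definition nonneg_supersolution_Q3 (R : realType) (n : nat) (p lam Lam : R)
    (u : 'rV[R]_n * R -> R) : Prop :=
  (forall z, Q3minus p z -> 0 <= u z) /\
  viscosity_supersolution p lam Lam (eball 0 3) (- (3 `^ p)) 0 u.

Definition property_P (R : realType) (n : nat) (p lam Lam m0 L0 : R) : Prop :=
  forall u : 'rV[R]_n * R -> R,
    nonneg_supersolution_Q3 p lam Lam u ->
    u (0, 0) <= m0 ->
    forall (x0 : 'rV[R]_n) (t0 : R),
      eball 0 (4 / 3) x0 -> - 3 < t0 <= - (1 / 2) ->
      exists2 xbar, eball x0 (1 / 32) xbar & u (xbar, t0) <= L0 * m0.

(* Main.v *)
Require Import Defs.
From HB Require Import structures.
From mathcomp Require Import all_boot all_order all_algebra.
From mathcomp Require Import all_classical all_reals all_analysis.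
From mathcomp Require Import ring lra.
Set Implicit Arguments.
Unset Strict Implicit.
Unset Printing Implicit Defensive.
Import Order.TTheory GRing.Theory Num.Theory.
Import numFieldNormedType.Exports.
Local Open Scope classical_set_scope.
Local Open Scope ring_scope.

(** The equation is invariant under (x, t) |-> (x1 + r x, t1 + s t) combined
    with u |-> u / m, provided s m^(p-2) = r^p, so property (P) may be applied
    at every scale.  The proof is an induction on k.  Suppose the claim holds
    at scale k, and let t0 be an admissible time for k+1.  With r = 32^-k,
    m = L0^k and s = r^p / m^(p-2), the time t1 = t0 + s/2 is still admissible
    for k: s <= r^p because m >= 1, and 32^-p <= 1/32, so t0 + s/2 lies below
    -1 + 32^(-kp).  The induction hypothesis gives x1 within r of x0 with
    u(x1, t1) <= m m0.  The rescaling v(x, t) = u(x1 + r x, t1 + s t) / m is a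
    nonnegative supersolution on the same cylinder with v(0, 0) <= m0; property
    (P) for v at time -1/2, which corresponds to the original time t0, gives a
    point within r/32 of x0 at which u <= m L0 m0.

    What needs an argument is that v is a viscosity supersolution on its own
    cylinder ([viscosity_supersolution_rescale]).  The rescaled cylinder is only
    a part of the original one, so a test function for v pulls back to a
    function which is neither C^2 nor below u on all of the original cylinder.
    Since u >= 0, this is repaired by a cutoff: if 0 <= eta <= 1 is supported
    near the contact point and equals 1 around it, then eta phi has the same
    derivatives as phi at the contact point and eta phi <= max(phi, 0) <= v,
    while eta phi vanishes away from that point
    ([localize_test_function]).  The cutoff is obtained from the C^2 function
    max(x, 0)^3 and the squared distance, which requires closure properties of
    the class [Ck_on], defined by iterated directional derivatives.  The
    remaining ingredients are the homogeneity of the Pucci operator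
    ([pucci_minusZ]) and the triangle inequality for the Euclidean norm. *)

(** * Functions of class C^k *)

(** It suffices that a function vanishing near a point is differentiable there,
    its increment being trivially negligible: apply this to g - f. *)
Lemma near_eq_differentiable (R : realType) (V W : normedModType R)
    (f g : V -> W) (z : V) :
  {near z, f =1 g} -> differentiable f z -> differentiable g z.
Proof.
move=> fg df; have -> : g = f + (g - f) by rewrite addrC subrK.
apply: differentiableD => //; set e := g - f.
have e0 : e z = 0 by rewrite /e !fctE (nbhs_singleton fg) subrr.
have ed : e \o shift z = cst (e z) + cst 0 +o_ 0 id.
  apply/eqaddoP => _/posnumP[r].
  have : \forall h \near (0 : V), f (h + z) = g (h + z).
    by have := fg; rewrite (near_shift 0 z (fun y => f y = g y)) /= subr0.
  apply: filterS => h /= fgh.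
  have -> : (e \o shift z - (cst (e z) + cst 0)) h = 0.
    by rewrite !fctE /= e0 /e !fctE fgh !subrr addr0 subr0.
  by rewrite normr0 mulr_ge0.
have e'0 : 'd e z = cst 0 :> (V -> W).
  apply: (@diff_unique _ _ _ e \0) => //; exact: cst_continuous.
by apply/diff_locallyP; rewrite e'0; split => //; exact: cst_continuous.
Qed.

Section Ck_calculus.
Context (R : realType) (V : normedModType R).
Implicit Types (f g : V -> R) (O : set V).

Lemma Ck_onW k O f : Ck_on k.+1 O f -> Ck_on k O f.
Proof.
elim: k f => [f [df _] z Oz|k ih f [df Df]].
  exact/differentiable_continuous/df.
by split=> // v; exact/ih/Df.
Qed.

Lemma Ck_on_eq k O f g : open O -> (forall z, O z -> f z = g z) ->
  Ck_on k O f -> Ck_on k O g.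
Proof.
move=> oO; elim: k f g => [|k ih] f g fg.
  move=> Cf z Oz; rewrite /prop_for /continuous_at -fg//.
  apply: cvg_trans (Cf z Oz); apply: near_eq_cvg.
  exact: filterS fg (open_nbhs_nbhs (conj oO Oz)).
have nfg z : O z -> {near z, f =1 g}.
  by move=> Oz; exact: filterS fg (open_nbhs_nbhs (conj oO Oz)).
move=> [df Df]; split=> [z Oz|v].
  exact: near_eq_differentiable (nfg z Oz) (df z Oz).
by apply: ih (Df v) => z Oz; apply/near_eq_derive/nfg.
Qed.

Lemma Ck_on_sub k O O' f : O' `<=` O -> Ck_on k O f -> Ck_on k O' f.
Proof.
move=> sub; elim: k f => [f Cf z /sub/Cf//|k ih f [df Df]].
by split=> [z /sub/df//|v]; exact/ih/Df.
Qed.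

Lemma Ck_onU k O O' f : Ck_on k O f -> Ck_on k O' f -> Ck_on k (O `|` O') f.
Proof.
elim: k f => [f Cf Cf' z [/Cf|/Cf']//|k ih f [df Df] [df' Df']].
by split=> [z [/df|/df']//|v]; apply: ih; [exact: Df|exact: Df'].
Qed.

Lemma Ck_on_cst k O (c : R) : Ck_on k O (cst c).
Proof.
elim: k c => [|k ih] c; first by move=> z _; exact: cst_continuous.
split=> [z _|v]; first exact: differentiable_cst.
by rewrite (_ : (fun z => 'D_v (cst c) z) = cst 0)//; apply/funext => z;
  rewrite derive_cst.
Qed.

Lemma Ck_onD k O f g : open O ->
  Ck_on k O f -> Ck_on k O g -> Ck_on k O (f + g).
Proof.
move=> oO; elim: k f g => [|k ih] f g.
  by move=> Cf Cg z Oz; apply: continuousD; [exact: Cf|exact: Cg].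
move=> [df Df] [dg Dg]; split=> [z Oz|v].
  by apply: differentiableD; [exact: df|exact: dg].
apply: Ck_on_eq (ih _ _ (Df v) (Dg v)) => // z Oz.
by rewrite deriveD//; apply: diff_derivable; [exact: df|exact: dg].
Qed.

Lemma Ck_onM k O f g : open O ->
  Ck_on k O f -> Ck_on k O g -> Ck_on k O (f * g).
Proof.
move=> oO; elim: k f g => [|k ih] f g.
  by move=> Cf Cg z Oz; apply: continuousM; [exact: Cf|exact: Cg].
move=> Cf Cg; have [df Df] := Cf; have [dg Dg] := Cg; split=> [z Oz|v].
  by apply: differentiableM; [exact: df|exact: dg].
apply: Ck_on_eq (Ck_onD oO (ih _ _ (Ck_onW Cf) (Dg v))
  (ih _ _ (Ck_onW Cg) (Df v))) => // z Oz.
by rewrite deriveM//; apply: diff_derivable; [exact: df|exact: dg].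
Qed.

Lemma Ck_on_linear k O (l : {linear V -> R}) : continuous l -> Ck_on k O l.
Proof.
move=> lc; case: k => [z _|k]; first exact: lc.
split=> [z _|v]; first exact: linear_differentiable.
rewrite (_ : (fun z => 'D_v l z) = cst (l v)); first exact: Ck_on_cst.
apply/funext => z; rewrite deriveE; last exact: linear_differentiable.
by rewrite diff_lin.
Qed.

End Ck_calculus.

(** The difference quotients of the two sides coincide. *)
Lemma derive_comp_affine (R : realType) (V W U : normedModType R) (f : W -> U)
    (A L : V -> W) :
    (forall h v z, A (h *: v + z) = h *: L v + A z) ->
  forall v z, 'D_v (f \o A) z = 'D_(L v) f (A z).
Proof.
move=> AL v z; rewrite /derive; set g1 := fun h => h^-1 *: _.
set g2 := fun h => h^-1 *: _; suff -> : g1 = g2 by [].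
by apply/funext => h; rewrite /g1 /g2 /= AL.
Qed.

Lemma Ck_on_comp_affine (R : realType) (V W : normedModType R)
    (k : nat) (O : set W) (f : W -> R) (A L : V -> W) :
    (forall z, differentiable A z) ->
    (forall h v z, A (h *: v + z) = h *: L v + A z) ->
  Ck_on k O f -> Ck_on k (A @^-1` O) (f \o A).
Proof.
move=> dA AL; elim: k f => [|k ih] f.
  move=> Cf z Oz; apply: continuous_comp; last exact: Cf.
  exact: differentiable_continuous.
move=> [df Df]; split=> [z Oz|v]; first exact/differentiable_comp/df.
rewrite (_ : (fun z => _) = 'D_(L v) f \o A); first exact/ih/Df.
by apply/funext => z; rewrite (derive_comp_affine _ AL).
Qed.

(** The truncated power: of class C^(m-1) and zero on the negative half-line,
    which makes it a substitute for the usual smooth bump. *)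
Definition pospow (R : realType) (m : nat) (x : R) : R := Num.max x 0 ^+ m.

Lemma pospow_ge0 (R : realType) m (x : R) : 0 <= pospow m x.
Proof. by rewrite exprn_ge0// le_max lexx orbT. Qed.

Lemma pospow_le0 (R : realType) m (x : R) : x <= 0 -> pospow m.+1 x = 0.
Proof. by move=> x0; rewrite /pospow max_r// expr0n. Qed.

Lemma pospow_ge0E (R : realType) m (x : R) : 0 <= x -> pospow m x = x ^+ m.
Proof. by move=> x0; rewrite /pospow max_l. Qed.

Lemma continuous_pospow (R : realType) m : continuous (@pospow R m).
Proof.
move=> x; apply: (@continuous_comp _ _ _ (fun x : R => Num.max x 0)
  (fun y => y ^+ m)).
  apply: (@continuous_max _ _ (id : R -> R) (cst 0)); first exact: cvg_id.
  exact: cvg_cst.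
exact: exprn_continuous.
Qed.

Lemma pospowS (R : realType) m (x : R) : pospow m.+2 x = x * pospow m.+1 x.
Proof.
have [x0|/ltW x0] := leP x 0; first by rewrite !pospow_le0// mulr0.
by rewrite !pospow_ge0E// exprS.
Qed.

Lemma is_derive_pospow (R : realType) m (x : R) :
  is_derive x 1 (@pospow R m.+2) (m.+2%:R * pospow m.+1 x).
Proof.
have [x0|x0|->] := ltgtP x 0.
- rewrite pospow_le0 ?ltW// mulr0.
  apply: (@near_eq_is_derive _ _ _ (cst 0)).
  by apply: filterS (lt_nbhsl x0) => y y0; rewrite pospow_le0// ltW.
- rewrite pospow_ge0E ?ltW//.
  apply: (@near_eq_is_derive _ R R ((id : R -> R) ^+ m.+2)).
    apply: filterS (lt_nbhsr x0) => y y0.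
    by rewrite pospow_ge0E ?ltW// exprfctE.
  have := @is_deriveX R R id m.+2 x 1 1 (is_derive_id _ _).
  by rewrite [_ *: _]mulr1.
- rewrite pospow_le0// mulr0.
  (* At 0 the difference quotient is the next lower truncated power. *)
  have c0 : (fun h : R => h^-1 *: ((pospow m.+2 \o shift 0) (h *: 1)
      - pospow m.+2 0)) @ 0^' --> (0 : R).
    have c1 : pospow m.+1 h @[h --> (0:R)^'] --> (0 : R).
      have := @continuous_pospow R m.+1 0; rewrite /continuous_at pospow_le0//.
      exact: cvg_within_filter.
    apply: cvg_trans c1; apply: near_eq_cvg; near=> h.
    have h0 : h != 0 by near: h; exact: nbhs_dnbhs_neq.
    rewrite /= addr0 [h *: 1]mulr1 [pospow _ 0]pospow_le0// subr0.
    by rewrite pospowS [_ *: _]mulrA mulVf// mul1r.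
  by apply: DeriveDef; [apply/cvg_ex; exists 0|exact: cvg_lim c0].
Unshelve. all: by end_near. Qed.

Lemma Ck_on_pospow (R : realType) (V : normedModType R) k m (O : set V)
    (f : V -> R) : (k < m)%N -> open O -> Ck_on k O f ->
  Ck_on k O (pospow m \o f).
Proof.
move=> + oO; elim: k m f => [|k ih] m f.
  move=> _ Cf z Oz; apply: continuous_comp; first exact: Cf.
  exact: continuous_pospow.
case: m => [//|[//|m]] km Cf; have [df Df] := Cf.
have dp x : differentiable (@pospow R m.+2) x.
  by apply/derivable1_diffP; have [] := is_derive_pospow m x.
split=> [z Oz|v]; first by apply: differentiable_comp; [exact: df|exact: dp].
apply: (@Ck_on_eq _ _ _ _ (cst m.+2%:R * (pospow m.+1 \o f) * 'D_v f)) => //.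
  move=> z Oz; have dfz := df z Oz; rewrite deriveE; last first.
    exact: differentiable_comp.
  rewrite diff_comp//= diff1E// derive1E -deriveE//.
  by have [_ ->] := is_derive_pospow m (f z); rewrite mulrC.
apply: Ck_onM (Df v) => //; apply: Ck_onM; [by []|exact: Ck_on_cst|].
by apply: ih => //; exact: Ck_onW.
Qed.

(** * Localization of test functions *)

Section cutoff.
Context (R : realType) (n : nat).
Implicit Types (z : 'rV[R]_n * R) (N O : set ('rV[R]_n * R)).

Definition sqdist z0 z : R :=
  \sum_(i < n) (z.1 0 i - z0.1 0 i) ^+ 2 + (z.2 - z0.2) ^+ 2.

Lemma Ck_on_affine (V : normedModType R) (k : nat) (O : set V) (A L : V -> R) :
    (forall x, differentiable A x) ->
    (forall h v x, A (h *: v + x) = h *: L v + A x) ->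
  Ck_on k O A.
Proof.
move=> dA AL; have idc : continuous (idfun : R -> R) by move=> x; exact: cvg_id.
apply: (@Ck_on_sub _ _ _ (A @^-1` setT)) => //.
exact: (Ck_on_comp_affine dA AL (Ck_on_linear _ _ (l := idfun) idc)).
Qed.

Lemma Ck_on_sum (V : normedModType R) (k : nat) (O : set V) m
    (f : 'I_m -> V -> R) :
  open O -> (forall i, Ck_on k O (f i)) -> Ck_on k O (\sum_(i < m) f i).
Proof.
move=> oO Cf; elim/big_ind: _ => //; first exact: Ck_on_cst.
by move=> g h; exact: Ck_onD.
Qed.

Lemma Ck_on_sqdist k z0 : Ck_on k setT (sqdist z0).
Proof.
pose f i z := z.1 0 i - z0.1 0 i; pose g z := z.2 - z0.2.
have -> : sqdist z0 = \sum_(i < n) f i * f i + g * g.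
  apply/funext => z; rewrite !fctE fct_sumE.
  by congr (_ + _); apply: eq_bigr => i _; rewrite fctE -expr2.
have d1 z : differentiable (fst : 'rV[R]_n * R -> 'rV[R]_n) z.
  apply: linear_differentiable; move=> w; exact: cvg_fst.
have Cf i : Ck_on k setT (f i).
  apply: (@Ck_on_affine _ k setT (f i) (fun v : 'rV[R]_n * R => v.1 0 i))
    => [z|h v z]; last first.
    by rewrite /f /= !mxE addrA.
  apply: differentiableB; last exact: differentiable_cst.
  exact: (differentiable_comp (d1 z) (differentiable_coord z.1 0 i)).
have Cg : Ck_on k setT g.
  apply: (@Ck_on_affine _ k setT g (fun v : 'rV[R]_n * R => v.2))
    => [z|h v z]; last first.
    by rewrite /g /= addrA.
  apply: differentiableB; last exact: differentiable_cst.
  apply: linear_differentiable; move=> w; exact: cvg_snd.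
apply: Ck_onD; [exact: openT| |apply: Ck_onM];
  [|exact: openT|exact: Cg|exact: Cg].
apply: Ck_on_sum => [|i]; first exact: openT.
apply: Ck_onM; [exact: openT|exact: Cf|exact: Cf].
Qed.

Lemma sqdist_coord z0 z :
  (forall i, (z.1 0 i - z0.1 0 i) ^+ 2 <= sqdist z0 z) /\
  (z.2 - z0.2) ^+ 2 <= sqdist z0 z.
Proof.
split=> [i|].
  rewrite /sqdist (bigD1 i)//= -addrA lerDl addr_ge0 ?sqr_ge0//.
  by rewrite sumr_ge0// => j _; exact: sqr_ge0.
by rewrite lerDr sumr_ge0// => j _; exact: sqr_ge0.
Qed.

Lemma sqdistzz z : sqdist z z = 0.
Proof.
rewrite /sqdist big1 ?subrr ?expr0n ?addr0// => i _.
by rewrite subrr expr0n.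
Qed.

Lemma nbhs_sqdist z0 N : nbhs z0 N ->
  exists2 e : R, 0 < e & forall z, sqdist z0 z < e -> N z.
Proof.
move=> /nbhs_ballP[e /= e0 eN]; exists (e ^+ 2); first exact: exprn_gt0.
have aux a b : (b - a) ^+ 2 < e ^+ 2 -> ball (a : R) e b.
  rewrite -ltr_sqrt ?exprn_gt0// !sqrtr_sqr (gtr0_norm e0) distrC.
  by rewrite -ball_normE.
move=> z ze; have [z1 z2] := sqdist_coord z0 z.
apply: eN; split; last exact/aux/(le_lt_trans z2).
by split=> // i j; rewrite !ord1; exact/aux/(le_lt_trans (z1 j)).
Qed.

(** With c = [pospow 3] and q the squared distance, eta is
    1 - c(1 - 8 c(1 - q/d)): the inner c vanishes once q >= d, and is at least
    (1/2)^3 = 1/8 when q <= d/2, which makes the argument of the outer c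
    nonpositive.  The open set on which eta vanishes lets a product eta phi be
    extended by 0 outside the domain where phi is regular. *)
Lemma cutoff z0 N : nbhs z0 N -> exists eta : 'rV[R]_n * R -> R,
  [/\ Ck_on 2 setT eta, forall z, 0 <= eta z <= 1, \near z0, eta z0 = 1 &
      exists2 O, open O & ~` N `<=` O /\ forall z, O z -> eta z = 0].
Proof.
move=> /nbhs_sqdist[e e0 eN]; pose d := e / 2.
have d0 : 0 < d by rewrite divr_gt0.
have C2c f : Ck_on 2 (@setT ('rV[R]_n * R)) f -> Ck_on 2 setT (pospow 3 \o f).
  by move=> Cf; apply: Ck_on_pospow Cf; [|exact: openT].
have C2a a b f : Ck_on 2 (@setT ('rV[R]_n * R)) f ->
    Ck_on 2 setT (cst a + cst b * f).
  move=> Cf; apply: Ck_onD; [exact: openT|exact: Ck_on_cst|].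
  apply: Ck_onM; [exact: openT|exact: Ck_on_cst|exact: Cf].
pose inner := cst 1 +
  cst (- 8) * (pospow 3 \o (cst 1 + cst (- d^-1) * sqdist z0)).
pose eta := cst 1 + cst (- 1) * (pospow 3 \o inner).
have innerE z : inner z = 1 - 8 * pospow 3 (1 - sqdist z0 z / d).
  by rewrite /inner !fctE !mulNr [d^-1 * _]mulrC.
have etaE z : eta z = 1 - pospow 3 (inner z).
  by rewrite /eta !fctE !mulNr mul1r.
have qc : continuous (sqdist z0).
  by move=> z; exact: (@Ck_on_sqdist 0 z0).
exists eta; split.
- exact/C2a/C2c/C2a/C2c/C2a/Ck_on_sqdist.
- move=> z; rewrite etaE.
  have i1 : inner z <= 1.
    by rewrite innerE gerBl mulr_ge0// pospow_ge0.
  rewrite gerBl pospow_ge0 andbT subr_ge0.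
  have [i0|/ltW i0] := leP (inner z) 0; first by rewrite pospow_le0.
  by rewrite pospow_ge0E// exprn_ile1.
- have : \forall z \near z0, sqdist z0 z < d / 2.
    apply: (cvgr_lt (sqdist z0 z0) (qc z0)).
    by rewrite sqdistzz divr_gt0.
  apply: filterS => z qd; rewrite etaE pospow_le0 ?subr0// innerE subr_le0.
  have h : 2^-1 <= 1 - sqdist z0 z / d.
    have : sqdist z0 z / d <= 2^-1 by rewrite ler_pdivrMr// mulrC ltW.
    lra.
  rewrite pospow_ge0E ?(le_trans _ h)//.
  have : 2^-1 ^+ 3 <= (1 - sqdist z0 z / d) ^+ 3.
    by rewrite lerXn2r ?nnegrE// (le_trans _ h).
  rewrite exprVn; lra.
- exists [set z | d < sqdist z0 z].
    have -> : [set z | d < sqdist z0 z] = sqdist z0 @^-1` [set x | d < x] by [].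
    by apply: open_comp => [z _|]; [exact: qc|exact: open_gt].
  split=> [z Nz /=|z /= /ltW dz].
    rewrite ltNge; apply/negP => zd; apply/Nz/eN/(le_lt_trans zd).
    by rewrite ltr_pdivrMr// ltr_pMr// ltr1n.
  have i1 : inner z = 1.
    rewrite innerE pospow_le0 ?mulr0 ?subr0//.
    by rewrite subr_le0 ler_pdivlMr// mul1r.
  by rewrite etaE i1 pospow_ge0E// expr1n subrr.
Qed.

(** Multiplication by a cutoff can only move the values of phi towards 0, so the
    result stays below max(phi, 0): this is why nonnegative supersolutions
    admit localized test functions. *)
Lemma localize_test_function z0 N O (phi : 'rV[R]_n * R -> R) :
    nbhs z0 N -> open O -> O z0 -> Ck_on 2 O phi ->
  exists psi : 'rV[R]_n * R -> R,
  [/\ Ck_on 2 setT psi, {near z0, phi =1 psi},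
      forall z, N z -> psi z <= Num.max (phi z) 0 &
      forall z, ~ N z -> psi z = 0].
Proof.
move=> nN oO Oz Cphi.
have : nbhs z0 (N `&` O) by apply: filterI => //; exact: open_nbhs_nbhs.
move=> /cutoff[eta [Ceta eta01 eta1 [Z oZ [NZ eta0]]]].
exists (eta * phi); split.
- suff -> : setT = O `|` Z.
    apply: Ck_onU; first by apply: Ck_onM Cphi; [|exact: Ck_on_sub Ceta].
    apply: (@Ck_on_eq _ _ _ _ (cst 0)); [by []| |exact: Ck_on_cst].
    by move=> z Zz; rewrite !fctE eta0// mul0r.
  apply/seteqP; split => // z _; have [Oz'|nOz] := pselect (O z); first by left.
  by right; apply: NZ => -[].
- by apply: filterS eta1 => z e1; rewrite !fctE e1 mul1r.
- move=> z _; rewrite !fctE; have /andP[e0 e1] := eta01 z.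
  have [p0|/ltW p0] := leP (phi z) 0; first by rewrite mulr_ge0_le0.
  by rewrite ler_piMl.
- by move=> z Nz; rewrite !fctE eta0 ?mul0r//; apply: NZ => -[].
Qed.

End cutoff.

(** * Homogeneity of the Pucci operator *)

(** char_poly (c *: M) splits exactly when char_poly M does, as c can be
    inverted; when they do not split, both lists take the default value. *)
Lemma eigenvaluesZ (R : realType) (n : nat) (c : R) (M : 'M[R]_n) :
  0 < c -> perm_eq (eigenvalues (c *: M)) [seq c * e | e <- eigenvalues M].
Proof.
have scale (a : R) (N : 'M[R]_n) (e : seq R) : 0 < a ->
    char_poly N = \prod_(x <- e) ('X - x%:P) ->
    char_poly (a *: N) = \prod_(x <- [seq a * x | x <- e]) ('X - x%:P).
  move=> a0 Ne; have an0 : a != 0 by rewrite gt_eqF.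
  have se : size e = n.
    by apply/eqP; rewrite -eqSS -(size_prod_XsubC e id) -Ne size_char_poly.
  (* The characteristic polynomial of a N is a^n chi_N(X / a). *)
  have aX : a%:P * (a^-1 *: 'X) = 'X.
    by rewrite mul_polyC scalerA mulfV// scale1r.
  have -> : char_poly (a *: N) = a%:P ^+ n * (char_poly N \Po (a^-1 *: 'X)).
    rewrite /char_poly -det_map_mx -detZ; congr (\det _).
    apply/matrixP => i j; rewrite !mxE /= rmorphB /= rmorphMn /=.
    by rewrite comp_polyX comp_polyC mulrBr mulrnAr aX -polyCM.
  rewrite Ne -se big_map; elim: (e) => [|x f ih].
    by rewrite !big_nil mul1r comp_polyC.
  rewrite !big_cons exprS rmorphM/= mulrACA ih rmorphB/= comp_polyX comp_polyC.
  by rewrite mulrBr aX -polyCM.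
move=> c0.
have eigP (N : 'M[R]_n) (e : seq R) :
    char_poly N = \prod_(x <- e) ('X - x%:P) ->
    char_poly N = \prod_(x <- eigenvalues N) ('X - x%:P).
  by move=> Ne; rewrite /eigenvalues; case: xgetP => [s _ //|/(_ e)].
have eig0 (N : 'M[R]_n) :
    (forall e : seq R, char_poly N <> \prod_(x <- e) ('X - x%:P)) ->
    eigenvalues N = [::].
  by move=> nN; rewrite /eigenvalues; case: xgetP => // e _ /nN.
have [[e Me]|nM] := pselect (exists e : seq R,
    char_poly M = \prod_(x <- e) ('X - x%:P)).
  apply: prod_XsubC_eq; rewrite -(eigP _ _ (scale _ _ _ c0 Me)).
  exact: scale c0 (eigP _ _ Me).
have -> : eigenvalues M = [::] by apply: eig0 => e Me; apply: nM; exists e.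
rewrite eig0// => e Me; apply: nM.
exists [seq c^-1 * x | x <- e]; rewrite -[M in LHS](scalerK (lt0r_neq0 c0)).
by apply: scale Me; rewrite invr_gt0.
Qed.

Lemma pucci_minusZ (R : realType) (n : nat) (lam Lam c : R) (M : 'M[R]_n) :
  0 < c -> pucci_minus lam Lam (c *: M) = c * pucci_minus lam Lam M.
Proof.
move=> c0; rewrite /pucci_minus !(perm_big _ (eigenvaluesZ M c0)) /=.
rewrite !big_map mulrDr !mulr_sumr; congr (_ + _).
  rewrite (eq_bigl (fun e => 0 < e)) => [|e]; last by rewrite pmulr_rgt0.
  by apply: eq_bigr => e _; rewrite mulrCA.
rewrite (eq_bigl (fun e => e < 0)) => [|e]; last by rewrite pmulr_rlt0.
by apply: eq_bigr => e _; rewrite mulrCA.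
Qed.

(** * The Euclidean norm *)

Section euclidean_norm.
Context (R : realType) (n : nat).
Implicit Types x y : 'rV[R]_n.

Lemma enorm_ge0 x : 0 <= enorm x.
Proof. exact: sqrtr_ge0. Qed.

Lemma enormE x : enorm x ^+ 2 = \sum_(i < n) x 0 i ^+ 2.
Proof. by rewrite sqr_sqrtr// sumr_ge0// => i _; exact: sqr_ge0. Qed.

Lemma enormZ (c : R) x : 0 <= c -> enorm (c *: x) = c * enorm x.
Proof.
move=> c0; rewrite /enorm -{2}(ger0_norm c0) -sqrtr_sqr -sqrtrM ?sqr_ge0//.
rewrite mulr_sumr; congr (Num.sqrt _).
by apply: eq_bigr => i _; rewrite mxE exprMn.
Qed.

Lemma enormN x : enorm (- x) = enorm x.
Proof. by congr (Num.sqrt _); apply: eq_bigr => i _; rewrite mxE sqrrN. Qed.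

(** Expand the sum of the squares of |y| x_i - |x| y_i, then divide by
    2 |x| |y| unless one of the vectors is 0. *)
Lemma cauchy_schwarz x y : \sum_(i < n) x 0 i * y 0 i <= enorm x * enorm y.
Proof.
set a := enorm x; set b := enorm y; set s := \sum_(i < n) _.
have a0 : 0 <= a := enorm_ge0 x; have b0 : 0 <= b := enorm_ge0 y.
have h : 0 <= 2 * (a * b) * (a * b - s).
  have -> : 2 * (a * b) * (a * b - s) =
      \sum_(i < n) (b * x 0 i - a * y 0 i) ^+ 2.
    under eq_bigr do rewrite sqrrB !exprMn.
    rewrite big_split/= sumrB -!mulr_sumr -!enormE -/a -/b.
    under eq_bigr do rewrite mulrACA.
    rewrite sumrMnl -mulr_sumr -/s; ring.
  by apply: sumr_ge0 => i _; exact: sqr_ge0.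
have [ab0|] := ltP 0 (a * b).
  by rewrite -subr_ge0; move: h; rewrite pmulr_rge0// mulr_gt0.
move=> ab_le0.
have z0 (w : 'rV[R]_n) : enorm w = 0 -> forall i, w 0 i = 0.
  move=> w0 i; have := enormE w; rewrite w0 expr0n/= => /esym/psumr_eq0P.
  move=> /(_ (fun j _ => sqr_ge0 _)) /(_ i isT)/eqP.
  by rewrite sqrf_eq0 => /eqP.
have : a * b == 0 by rewrite eq_le ab_le0 mulr_ge0.
rewrite mulf_eq0 => /orP[]/eqP e0; rewrite /s big1 ?mulr_ge0// => i _.
  by rewrite (z0 _ e0) mul0r.
by rewrite (z0 _ e0) mulr0.
Qed.

Lemma enormD x y : enorm (x + y) <= enorm x + enorm y.
Proof.
rewrite -ler_sqr ?nnegrE ?addr_ge0 ?enorm_ge0// sqrrD !enormE.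
under eq_bigr do rewrite mxE sqrrD.
rewrite 2!big_split sumrMnl lerD2r lerD2l lerMn2r.
exact: cauchy_schwarz.
Qed.

Lemma open_eball x (r : R) : open (eball x r).
Proof.
have c : continuous (fun y => enorm (y - x)).
  have -> : (fun y => enorm (y - x)) =
      Num.sqrt \o (sqdist (x, 0) \o (fun y => (y, 0 : R))).
    apply/funext => y /=; congr (Num.sqrt _).
    rewrite /sqdist subrr expr0n addr0.
    by apply: eq_bigr => i _; rewrite !mxE.
  move=> y; apply: continuous_comp; last exact: sqrt_continuous.
  apply: continuous_comp; last exact: (@Ck_on_sqdist _ _ 0).
  exact: (cvg_pair (G := nbhs y) (H := nbhs (0 : R)) cvg_id (cvg_cst _)).
have -> : eball x r = (fun y => enorm (y - x)) @^-1` [set a | a < r] by [].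
by apply: open_comp => [y _|]; [exact: c|exact: open_lt].
Qed.

End euclidean_norm.

(** * Scaling invariance *)

Section rescaling.
Context (R : realType) (n : nat).
Local Notation spacetime := ('rV[R]_n * R)%type.
Implicit Types (z v w : spacetime) (f phi u : spacetime -> R).

Definition rescale (x1 : 'rV[R]_n) (t1 r s : R) z : spacetime :=
  (x1 + r *: z.1, t1 + s * z.2).

Definition unscale (x1 : 'rV[R]_n) (t1 r s : R) : spacetime -> spacetime :=
  rescale (- (r^-1 *: x1)) (- (s^-1 * t1)) r^-1 s^-1.

Lemma rescaleK x1 t1 r s : r != 0 -> s != 0 ->
  cancel (rescale x1 t1 r s) (unscale x1 t1 r s).
Proof.
move=> r0 s0 [x t]; congr pair; rewrite /=.
  by rewrite scalerDr addKr scalerK.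
by rewrite mulrDr addKr mulKf.
Qed.

Lemma unscaleK x1 t1 r s : r != 0 -> s != 0 ->
  cancel (unscale x1 t1 r s) (rescale x1 t1 r s).
Proof.
move=> r0 s0 [x t]; congr pair; rewrite /=.
  by rewrite scalerDr scalerN !scalerKV// addNKr.
by rewrite mulrDr mulrN !mulVKf// addNKr.
Qed.

Lemma differentiable_rescale x1 t1 r s z : differentiable (rescale x1 t1 r s) z.
Proof.
have d1 : differentiable (fst : spacetime -> 'rV[R]_n) z.
  by apply: linear_differentiable; move=> w; exact: cvg_fst.
have d2 : differentiable (snd : spacetime -> R) z.
  by apply: linear_differentiable; move=> w; exact: cvg_snd.
apply: (@differentiable_pair _ _ _ _ (cst x1 + r *: fst) (cst t1 + s *: snd)).
  apply: differentiableD; [exact: differentiable_cst|exact: differentiableZ].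
apply: differentiableD; [exact: differentiable_cst|exact: differentiableZ].
Qed.

Lemma rescale_affine x1 t1 r s h v z :
  rescale x1 t1 r s (h *: v + z) = h *: rescale 0 0 r s v + rescale x1 t1 r s z.
Proof.
congr pair; rewrite /= !add0r.
  by rewrite scalerDr addrCA !scalerA [r * h]mulrC.
by rewrite mulrDr addrCA [h *: (s * _)]mulrCA.
Qed.

Lemma derive_rescale x1 t1 r s (m c : R) f v w z :
    (forall y, differentiable f y) -> rescale 0 0 r s v = c *: w ->
  'D_v (fun y => m * f (rescale x1 t1 r s y)) z =
  m * c * 'D_w f (rescale x1 t1 r s z).
Proof.
move=> df vw; have dc : differentiable (f \o rescale x1 t1 r s) z.
  by apply: differentiable_comp; [exact: differentiable_rescale|exact: df].
rewrite (deriveMl m (diff_derivable dc)).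
rewrite (derive_comp_affine _ (rescale_affine x1 t1 r s)) vw !deriveE//.
by rewrite linearZ mulrA.
Qed.

Lemma rescale_dx0 r s (j : 'I_n) :
  rescale 0 0 r s (delta_mx 0 j, 0) = r *: (delta_mx 0 j, 0).
Proof. by congr pair; rewrite /= add0r// mulr0 scaler0. Qed.

Lemma rescale_dt0 r s : rescale 0 0 r s (0, 1) = s *: (0, 1).
Proof. by congr pair; rewrite /= add0r// !scaler0. Qed.

Lemma grad_rescale x1 t1 r s (m : R) f z : (forall y, differentiable f y) ->
  grad (fun y => m * f (rescale x1 t1 r s y)) z =
  (m * r) *: grad f (rescale x1 t1 r s z).
Proof.
move=> df; apply/rowP => j; rewrite !mxE.
exact: derive_rescale (rescale_dx0 r s j).
Qed.

Lemma dt_rescale x1 t1 r s (m : R) f z : (forall y, differentiable f y) ->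
  dt (fun y => m * f (rescale x1 t1 r s y)) z =
  m * s * dt f (rescale x1 t1 r s z).
Proof. by move=> df; exact: derive_rescale (rescale_dt0 r s). Qed.

Lemma hess_rescale x1 t1 r s (m : R) f z : Ck_on 2 setT f ->
  hess (fun y => m * f (rescale x1 t1 r s y)) z =
  (m * r * r) *: hess f (rescale x1 t1 r s z).
Proof.
move=> [df Df]; apply/matrixP => i j; rewrite !mxE.
rewrite {1}/dx (_ : dx j _ = fun y => m * r * dx j f (rescale x1 t1 r s y)).
  apply: derive_rescale (rescale_dx0 r s i) => y.
  by have [+ _] := Df (delta_mx 0 j, 0); apply.
by apply/funext => y; apply: derive_rescale (rescale_dx0 r s j) => w; exact: df.
Qed.

Lemma near_eq_dt f phi z : {near z, f =1 phi} -> dt f z = dt phi z.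
Proof. exact: near_eq_derive. Qed.

Lemma near_eq_grad f phi z : {near z, f =1 phi} -> grad f z = grad phi z.
Proof. by move=> fp; apply/rowP => j; rewrite !mxE; exact: near_eq_derive. Qed.

Lemma near_eq_hess f phi z : {near z, f =1 phi} -> hess f z = hess phi z.
Proof.
move=> fp; apply/matrixP => i j; rewrite !mxE; apply: near_eq_derive.
by apply: filterS (near_join fp) => y; exact: near_eq_derive.
Qed.

(** Outside Omega' the points of the subspace are isolated, so the property only
    has content on Omega', where the map A is continuous into Omega. *)
Lemma lower_semicontinuous_rescale (A : spacetime -> spacetime)
    (Omega Omega' : set spacetime) (m : R) u : 0 < m -> continuous A ->
    (forall z, Omega' z -> Omega (A z)) ->
    lower_semicontinuous (fun z : subspace Omega => (u z)%:E) ->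
  lower_semicontinuous (fun z : subspace Omega' => (m * u (A z))%:E).
Proof.
move=> m0 cA AO lu z a; rewrite lte_fin => az.
have [Oz|nOz] := pselect (Omega' z); last first.
  exists [set z]; last by move=> y ->; rewrite lte_fin.
  by case: (nbhs_subspaceP Omega' z) => // _ y ->.
have [|V nV Va] := lu (A z) (m^-1 * a).
  by rewrite lte_fin ltr_pdivrMl.
exists (Omega' `&` A @^-1` (fun y => Omega y -> V y)).
  have Az : nbhs (A z) (fun y => Omega y -> V y).
    by move: nV; case: (nbhs_subspaceP Omega (A z)) => // /(_ (AO z Oz)).
  case: (nbhs_subspaceP Omega' z) => // _.
  have {}Az : nbhs (z : spacetime) (A @^-1` (fun y => Omega y -> V y)).
    exact: cA z _ Az.
  by apply: filterS Az => y yV Oy; split.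
move=> y [Oy yV]; have := Va _ (yV (AO _ Oy)).
by rewrite !lte_fin ltr_pdivrMl.
Qed.

(** For a test function phi of the rescaled function, m psi o B tests u, where
    psi is a localization of phi and B the inverse of the affine map A.  Its
    time derivative carries the factor m/s and the second-order term the factor
    (m/r)^(p-2) m/r^2; the relation s m^(p-2) = r^p makes them equal.  Openness
    of U' leaves room for the localization in space; in time the localization
    may extend beyond T2', since only times before the contact matter. *)
Lemma viscosity_supersolution_rescale (p lam Lam : R) (U U' : set 'rV[R]_n)
    (T1 T2 T1' T2' : R) u (x1 : 'rV[R]_n) (t1 r s m : R) :
    0 < r -> 0 < s -> 0 < m -> s * m `^ (p - 2) = r `^ p ->
    open U' ->
    (forall z, cylinder U' T1' T2' z ->
      cylinder U T1 T2 (rescale x1 t1 r s z)) ->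
    (forall z, cylinder U T1 T2 z -> 0 <= u z) ->
    viscosity_supersolution p lam Lam U T1 T2 u ->
  viscosity_supersolution p lam Lam U' T1' T2'
    (fun z => m^-1 * u (rescale x1 t1 r s z)).
Proof.
move=> r0 s0 m0 smr oU' sub u0 [lu vu]; set A := rescale x1 t1 r s.
have rn0 : r != 0 by rewrite gt_eqF.
have sn0 : s != 0 by rewrite gt_eqF.
pose B := unscale x1 t1 r s.
split.
  have cA : continuous A.
    by move=> z; exact/differentiable_continuous/differentiable_rescale.
  by apply: lower_semicontinuous_rescale cA sub lu; rewrite invr_gt0.
move=> phi x0 t0 [G [oG OG Cphi]] Oz0 phi_le phi_eq.
pose N : set spacetime := U' `*` [set t | T1' < t].
have nN : nbhs (x0, t0) N.
  case: Oz0 => /= Ux0; rewrite in_itv/= => /andP[Tt0 _].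
  exists (U', [set t | T1' < t]) => //; split; first exact: open_nbhs_nbhs.
  exact: lt_nbhsr.
have [psi [Cpsi psi_near psi_le psi0]] :=
  localize_test_function nN oG (OG _ Oz0) Cphi.
have dpsi y : differentiable psi y by case: Cpsi => + _; apply.
pose Phi z := m * psi (B z).
have BA : cancel A B by exact: rescaleK.
have AB : cancel B A by exact: unscaleK.
have CPhi : C2 (cylinder U T1 T2) Phi.
  exists setT; split; [exact: openT|by []|].
  have -> : Phi = cst m * (psi \o B) by apply/funext.
  apply: Ck_onM; [exact: openT|exact: Ck_on_cst|].
  exact: (Ck_on_comp_affine (@differentiable_rescale _ _ _ _)
    (@rescale_affine _ _ _ _) Cpsi).
have Phi_le x t : cylinder U T1 T2 (x, t) -> t <= (A (x0, t0)).2 ->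
    Phi (x, t) <= u (x, t).
  move=> Oxt tt0; rewrite /Phi; set y := B (x, t).
  have yt : y.2 <= t0.
    rewrite -[t0]/((x0, t0).2) -(BA (x0, t0)) /y /B /unscale /=.
    by rewrite lerD2l ler_pM2l ?invr_gt0.
  have [Ny|/psi0->] := pselect (N y); last by rewrite mulr0 u0.
  have Oy : cylinder U' T1' T2' y.
    case: (Ny) => /= Uy Ty; split=> //=; rewrite in_itv/= Ty/=.
    by case: Oz0 => _ /=; rewrite in_itv/= => /andP[_]; exact: le_trans.
  rewrite mulrC -ler_pdivlMr// (le_trans (psi_le y Ny))// ge_max.
  rewrite (divr_ge0 (u0 _ Oxt) (ltW m0)) andbT mulrC -[(x, t)]AB -/y.
  by rewrite [y]surjective_pairing phi_le// -surjective_pairing.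
have Phi_eq : Phi (A (x0, t0)) = u (A (x0, t0)).
  by rewrite /Phi BA -(nbhs_singleton psi_near) phi_eq mulVKf ?gt_eqF.
have := vu Phi _ _ CPhi (sub _ Oz0) Phi_le Phi_eq.
rewrite -/(rescale x1 t1 r s (x0, t0)) -/A.
have -> : dt Phi (A (x0, t0)) = m * s^-1 * dt phi (x0, t0).
  by rewrite (near_eq_dt psi_near) -[in RHS](BA (x0, t0)); exact: dt_rescale.
have -> : grad Phi (A (x0, t0)) = (m * r^-1) *: grad phi (x0, t0).
  rewrite (near_eq_grad psi_near) -[in RHS](BA (x0, t0)).
  exact: grad_rescale.
have -> : hess Phi (A (x0, t0)) = (m * r^-1 * r^-1) *: hess phi (x0, t0).
  rewrite (near_eq_hess psi_near) -[in RHS](BA (x0, t0)).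
  exact: hess_rescale.
have mr0 : 0 < m * r^-1 by rewrite divr_gt0.
have mrr0 : 0 < m * r^-1 * r^-1 by rewrite divr_gt0.
rewrite pucci_minusZ// (enormZ _ (ltW mr0)) powRM ?enorm_ge0 ?(ltW mr0)//.
set g := enorm _ `^ _; set P := pucci_minus _ _ _.
(* Both sides are m^(p-1) / r^p. *)
have -> : m * s^-1 = (m * r^-1) `^ (p - 2) * (m * r^-1 * r^-1).
  have rp : r `^ p = r `^ (p - 2) * r ^+ 2.
    by rewrite -powR_mulrn ?ltW// -powRD ?subrK// rn0 implybT.
  have rNp : r^-1 `^ (p - 2) = (r `^ (p - 2))^-1.
    by rewrite -[r^-1]powR_inv1 ?ltW// -powRrM mulN1r powRN.
  have b0 : r `^ (p - 2) != 0 by rewrite gt_eqF// powR_gt0.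
  rewrite powRM ?invr_ge0 ?ltW// rNp.
  have -> : m `^ (p - 2) = r `^ (p - 2) * r ^+ 2 / s.
    by rewrite -rp -smr mulrAC mulfV// mul1r.
  by field; rewrite ?rn0 ?sn0 ?b0.
by rewrite mulrACA -mulrBr pmulr_rge0// mulr_gt0// powR_gt0.
Qed.

End rescaling.

(** * Iteration over the scales *)

Lemma nonneg_supersolution_Q3_rescale (R : realType) (n : nat)
    (p lam Lam : R) (u : 'rV[R]_n * R -> R) (x1 : 'rV[R]_n) (t1 r s m : R) :
    0 < r -> 0 < s -> 0 < m -> s * m `^ (p - 2) = r `^ p ->
    (forall z, Q3minus p z -> Q3minus p (rescale x1 t1 r s z)) ->
    nonneg_supersolution_Q3 p lam Lam u ->
  nonneg_supersolution_Q3 p lam Lam (fun z => m^-1 * u (rescale x1 t1 r s z)).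
Proof.
move=> r0 s0 m0 smr sub [u0 vu]; split.
  by move=> z /sub/u0; apply: mulr_ge0; rewrite invr_ge0 ltW.
by apply: viscosity_supersolution_rescale vu => //; exact: open_eball.
Qed.

(** In space 4/3 + 1/32 + 3/32 < 3.  In time the lower end -3 - 3^p/32 is above
    -3^p because 3^p >= 9. *)
Lemma rescale_Q3minus (R : realType) (n : nat) (p r s : R) (x0 x1 : 'rV[R]_n)
    (t1 : R) (z : 'rV[R]_n * R) :
    2 < p -> 0 < r <= 1 / 32 -> 0 < s <= 1 / 32 ->
    eball 0 (4 / 3) x0 -> eball x0 r x1 -> - 3 < t1 <= 0 ->
  Q3minus p z -> Q3minus p (rescale x1 t1 r s z).
Proof.
move=> p2 /andP[r0 r1] /andP[s0 s1]; rewrite /eball /= subr0 => x0b x1b.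
move=> /andP[t1l t1r] [/=]; rewrite /eball /= subr0 in_itv/= => xb /andP[tl tr].
split=> /=.
  rewrite /eball /= subr0 -{1}(subrK x0 x1).
  apply: le_lt_trans (enormD _ _) _; rewrite (enormZ _ (ltW r0)).
  apply: (@le_lt_trans _ _ (enorm (x1 - x0) + enorm x0 + r * enorm z.1)).
    by rewrite lerD2r enormD.
  have : r * enorm z.1 <= 1 / 32 * 3.
    by apply: ler_pM => //; [exact: ltW|exact: enorm_ge0|exact: ltW].
  lra.
have p9 : 9 <= 3 `^ p.
  rewrite (_ : 9 = 3 `^ 2%:R); first by rewrite ler_powR ?ler1n// ltW.
  by rewrite powR_mulrn//; lra.
rewrite in_itv/=; apply/andP; split; last by nra.
have : s * - z.2 <= 1 / 32 * 3 `^ p.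
  have [z20|z20] := leP 0 (- z.2); last by nra.
  by apply: ler_pM; rewrite ?(ltW s0)//; lra.
nra.
Qed.

Theorem lemma4p3 (R : realType) (n : nat) (p lam Lam m0 L0 : R)
    (hn : (1 <= n)%N) (hp : 2 < p) (hlam : 0 < lam) (hLam : lam <= Lam)
    (hm0 : 0 < m0 < 1) (hL0 : 1 < L0)
    (hP : property_P n p lam Lam m0 L0)
    (u : 'rV[R]_n * R -> R)
    (hu : nonneg_supersolution_Q3 p lam Lam u)
    (hu0 : u (0, 0) <= m0)
    (k : nat) (hk : (1 <= k)%N)
    (x0 : 'rV[R]_n) (t0 : R)
    (hx0 : eball 0 (4 / 3) x0)
    (ht0 : - 3 < t0 <= - 1 + 32 `^ (- (k%:R * p))) :
  exists2 xbar, eball x0 (32 ^- k) xbar & u (xbar, t0) <= L0 ^+ k * m0.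
Proof.
have e1 : 32 `^ (- p) <= 1 / 32 :> R.
  have -> : 1 / 32 = 32 `^ (- 1) :> R by rewrite powR_inv1// mul1r.
  by rewrite ler_powR ?ler1n// lerN2; lra.
case: k hk t0 ht0 => // k _; elim: k => [|k ih] t0 /andP[t0l t0r].
  rewrite !expr1; rewrite mul1r in t0r.
  have [|xb xbB uxb] := hP u hu hu0 x0 t0 hx0; first by apply/andP; split; lra.
  by exists xb => //; rewrite -[_^-1]mul1r.
set j := k.+1 in ih t0r *.
pose r : R := 32 ^- j; pose m := L0 ^+ j; pose s := r `^ p / m `^ (p - 2).
have r0 : 0 < r by rewrite invr_gt0 exprn_gt0.
have r1 : r <= 1 / 32.
  rewrite mul1r lef_pV2 ?posrE ?exprn_gt0// -[leLHS]expr1.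
  by rewrite ler_weXn2l// ler1n.
have m1 : 1 <= m by rewrite exprn_ege1// ltW.
have mpos : 0 < m by lra.
have mp1 : 1 <= m `^ (p - 2).
  by rewrite -{1}(powRr0 m) ler_powR//; lra.
have mp0 : 0 < m `^ (p - 2) := lt_le_trans ltr01 mp1.
have rp0 : 0 < r `^ p by rewrite powR_gt0.
have s0 : 0 < s by rewrite divr_gt0.
have srp : s <= r `^ p by rewrite ler_pdivrMr// ler_peMr// ltW.
have smr : s * m `^ (p - 2) = r `^ p by rewrite /s divfK// gt_eqF.
have rpE : r `^ p = 32 `^ (- (j%:R * p)) by rewrite -mulNr powRrM powR_invn.
have rp1 : r `^ p <= 1 / 32.
  rewrite rpE (le_trans _ e1)// ler_powR ?ler1n// lerN2 ler_peMl ?ler1n//; lra.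
have rpS : 32 `^ (- (j.+1%:R * p)) = r `^ p * 32 `^ (- p).
  by rewrite rpE -powRD ?pnatr_eq0 ?implybT// -natr1; congr (_ `^ _); ring.
rewrite -rpE in ih; rewrite rpS in t0r.
pose t1 := t0 + s / 2.
have t1l : - 3 < t1 by rewrite /t1; lra.
have t1r : t1 <= - 1 + r `^ p by rewrite /t1; nra.
have [|x1 x1B ux1] := ih t1; first by rewrite t1l t1r.
pose y := r^-1 *: (x0 - x1).
have yB : eball 0 (4 / 3) y.
  rewrite /eball /= subr0 enormZ ?invr_ge0 ?ltW// -enormN opprB.
  rewrite mulrC ltr_pdivrMr//; move: x1B; rewrite /eball/= -/r; nra.
(* The time -1/2 of the rescaled function is the time t1 - s/2 = t0 of u. *)
have [|||yb ybB uyb] :=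
  hP (fun z => m^-1 * u (rescale x1 t1 r s z)) _ _ y (- (1 / 2)) yB.
- apply: nonneg_supersolution_Q3_rescale => // z.
  by apply: rescale_Q3minus hx0 x1B _ => //; apply/andP; split=> //; lra.
- by rewrite /rescale /= scaler0 mulr0 !addr0 ler_pdivrMl.
- by apply/andP; split; lra.
exists (x1 + r *: yb).
  rewrite /eball /= (_ : _ - x0 = r *: (yb - y)); last first.
    by rewrite scalerBr scalerKV ?gt_eqF// opprB [RHS]addrCA addrA.
  rewrite (enormZ _ (ltW r0)) exprS invfM mulrC -/r ltr_pM2r//.
  by move: ybB; rewrite /eball/= mul1r.
move: uyb; rewrite /rescale /= ler_pdivrMl// exprS => uyb.
rewrite (_ : t0 = t1 + s * - (1 / 2)); last by rewrite /t1; field.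
by rewrite [leRHS]mulrAC [leRHS]mulrC.
Qed.
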